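(* Let $I$ be a monomial ideal in the polynomial ring $R=K[x_1,\ldots,x_n]$. Then the following statements are equivalent: (i) $I$ is a Lyubeznik ideal. (ii) There exists a total order $<$ on $G(I)$ such that for every element $u$ of $G(I)$ and every cover $C$ of $u$, $C$ is not preserved. (iii) There exists a total order $<$ on $G(I)$ such that for every element $u$ of $G(I)$ and every cover $C$ of $u$, there exist $D\subseteq C$ and $v\in G(I)$ with $v\notin D$, such that $D\cup\{v\}$ is a cover of $v$ and $\min(\overline{D}-D)<\min(D)$. (iv) There exists a total order $<$ on $G(I)$ such that for every element $u$ of $G(I)$ and every $E$-minimal cover $C$ of $u$, $C$ is not preserved. (v) There exists a total order $<$ on $G(I)$ such that for every element $u$ of $G(I)$ and every $E$-minimal cover $C$ of $u$, there exist $D\subseteq C$ and $v\in G(I)$ with $v\notin D$, such that $D\cup\{v\}$ is an $E$-minimal cover of $v$ and $\min(\overline{D}-D)<\min(D)$.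
   Context: $K$ is a field and $G(I)$ denotes the minimal set of monomial generators of $I$. For a total order $<$ on $G(I)$ write $G(I)=\{m_1<\cdots<m_\mu\}$. For $A\subseteq G(I)$, $\mathrm{lcm}(A)$ is the least common multiple of the elements of $A$ and $\min(A)$ is its least element under $<$. Covers: a subset $C\subseteq G(I)$ is a cover of $u\in C$ if $u\mid\mathrm{lcm}(C-\{u\})$. A cover $C$ of $u$ is an $E$-minimal cover of $u$ if no proper subset of $C$ is a cover of $u$. For $D\subseteq G(I)$, $\overline{D}=\{w\in G(I): w\mid\mathrm{lcm}(D)\}$. Preserved sets: a (nonempty) subset $D\subseteq G(I)$ is broken (under $<$) if there is $u\in G(I)$ with $u\mid\mathrm{lcm}(D)$ and $u<\min(D)$. A subset $E\subseteq G(I)$ is preserved (under $<$) if no subset of $E$ is broken. Lyubeznik resolution with respect to $<$: a symbol is $u(i_1;\ldots;i_t)$ with $1\le i_1<\cdots<i_t\le\mu$; it is $L$-admissible (of dimension $t$) if for all $h<t$ and all $q<i_h$, $m_q$ does not divide $\mathrm{lcm}(m_{i_h},\ldots,m_{i_t})$. The Lyubeznik resolution is the free resolution of $R/I$ with $L^0=R$, $L^t$ the free $R$-module on the $L$-admissible symbols of dimension $t$, and $$\partial_t(u(i_1;\ldots;i_t))=\sum_{j=1}^t(-1)^{j+1}\frac{\mathrm{lcm}(m_{i_1},\ldots,m_{i_t})}{\mathrm{lcm}(m_{i_1},\ldots,\widehat{m_{i_j}},\ldots,m_{i_t})}\,u(i_1;\ldots;\widehat{i_j};\ldots;i_t).$$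 $I$ is a Lyubeznik ideal if there is a total order on $G(I)$ for which the corresponding Lyubeznik resolution is a minimal free resolution of $R/I$. *)

(* Defs.v *)
From HB Require Import structures.
From Stdlib Require Import ClassicalEpsilon.
From mathcomp Require Import all_boot all_order all_algebra.
From mathcomp Require Import finmap.
From mathcomp Require Import mpoly.

Set Implicit Arguments.
Unset Strict Implicit.
Unset Printing Implicit Defensive.

Import GRing.Theory.

Local Open Scope ring_scope.
Local Open Scope fset_scope.

Section MonomialIdeals.
Variables (K : fieldType) (n : nat).
Local Notation R := {mpoly K[n]}.
Local Notation mon := 'X_{1..n}.

Definition in_monomial_span (S : mon -> Prop) (f : R) : Prop :=
  exists2 c : seq (R * mon),
    (forall p, p \in c -> S p.2) & f = \sum_(p <- c) p.1 * 'X_[p.2].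

Definition generates (S : mon -> Prop) (I : {pred R}) : Prop :=
  forall f, (f \in I) <-> in_monomial_span S f.

(* The zero ideal (S empty) and the unit ideal (1 in S) are included. *)
Definition monomial_ideal (I : {pred R}) : Prop :=
  exists S : mon -> Prop, generates S I.

Definition is_min_generators (I : {pred R}) (G : {fset mon}) : Prop :=
  generates (fun m => m \in G) I /\
  forall G' : {fset mon}, G' `<` G -> ~ generates (fun m => m \in G') I.

(* G(I). Monomials are represented by their exponent vectors. The property
   selected by epsilon is satisfiable for monomial ideals, see
   [min_generatorsP]. *)
Definition min_generators (I : {pred R}) : {fset mon} :=
  epsilon (inhabits (fset0 : {fset mon})) (is_min_generators I).

Lemma dickson (P : mon -> Prop) :
  exists2 F : seq mon, (forall f, f \in F -> P f) &
    forall m, P m -> exists2 f, f \in F & (f <= m)%MM.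
Proof.
pose x (m : mon) (i : nat) := if insub i is Some j then m j else 0%N.
suff D k (Q : mon -> Prop) : exists2 F : seq mon, (forall f, f \in F -> Q f) &
    forall m, Q m -> exists2 f, f \in F & forall i, (i < k)%N -> (x f i <= x m i)%N.
  have [F FP hF] := D n P; exists F => // m /hF [f fF le_fm].
  exists f => //; apply/mnm_lepP => i.
  by have := le_fm i (ltn_ord i); rewrite /x valK.
elim: k Q => [|k IHk] Q.
  have [[m Qm]|nQ] := classic (exists m, Q m).
    by exists [:: m] => [f|m' _]; [rewrite inE => /eqP->|exists m; rewrite ?inE].
  by exists [::] => // m Qm; case: nQ; exists m.
have [F FQ hF] := IHk Q.
pose N := \max_(f <- F) x f k.
have [G GQ hG] : exists2 G : seq mon, (forall f, f \in G -> Q f) &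
    forall m, Q m -> (x m k < N)%N -> exists2 f, f \in G &
    forall i, (i < k.+1)%N -> (x f i <= x m i)%N.
  elim: N => [|c [G GQ hG]]; first by exists [::].
  have [H HQ hH] := IHk (fun m => Q m /\ x m k = c).
  exists (G ++ H) => [f|m Qm].
    by rewrite mem_cat => /orP[/GQ|/HQ[]].
  rewrite ltnS leq_eqVlt => /orP[/eqP mc|lt_mc].
    have [f fH le_fm] := hH m (conj Qm mc); exists f; rewrite ?mem_cat ?fH ?orbT //.
    move=> i; rewrite ltnS leq_eqVlt => /orP[/eqP->|/le_fm//].
    by rewrite mc (HQ f fH).2.
  by have [f fG le_fm] := hG m Qm lt_mc; exists f; rewrite ?mem_cat ?fG.
exists (F ++ G) => [f|m Qm]; first by rewrite mem_cat => /orP[/FQ|/GQ].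
have [lt_mN|le_Nm] := ltnP (x m k) N.
  by have [f fG le_fm] := hG m Qm lt_mN; exists f; rewrite ?mem_cat ?fG ?orbT.
have [f fF le_fm] := hF m Qm; exists f; rewrite ?mem_cat ?fF //.
move=> i; rewrite ltnS leq_eqVlt => /orP[/eqP->|/le_fm//].
apply: leq_trans le_Nm; rewrite /N.
by rewrite (big_rem f) //= leq_maxl.
Qed.

Lemma min_generatorsP (I : {pred R}) :
  monomial_ideal I -> is_min_generators I (min_generators I).
Proof.
move=> [S genS]; apply: epsilon_spec.
have [F FS hF] := dickson S.
have genF : generates (fun m => m \in [fset m in F]) I.
  move=> f; rewrite genS; split=> -[c cS ->].
    elim: c cS => [|[a m] c IHc] cS; first by exists [::]; rewrite ?big_nil.
    have [|d dF eq_d] := IHc; first by move=> p pc; apply: cS; rewrite inE pc orbT.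
    have [|g gF le_gm] := hF m; first by apply: (cS (a, m)); rewrite inE eqxx.
    exists ((a * 'X_[m - g], g) :: d) => [p|].
      by rewrite inE => /orP[/eqP->|/dF//]; rewrite !inE.
    by rewrite !big_cons /= eq_d -mulrA -mpolyXD submK.
  by exists c => // p /cS; rewrite !inE => /FS.
elim: {F FS hF}_.+1 {-2}[fset m in F] (ltnSn #|` [fset m in F]|) genF => // N IHN G.
rewrite ltnS => leGN genG.
have [[G' ltG' genG']|noG'] := classic (exists2 G' : {fset mon},
    G' `<` G & generates (fun m => m \in G') I); last first.
  by exists G; split=> // G' ltG' genG'; apply: noG'; exists G'.
by apply: (IHN G') => //; apply: leq_trans leGN; apply: fproper_ltn_card.
Qed.

End MonomialIdeals.

Section Covers.
Variable n : nat.
Local Notation mon := 'X_{1..n}.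
Implicit Types (G C D E : {fset mon}) (lt : rel mon) (u v w : mon).

Definition mlcms (s : seq mon) : mon := \big[@mlcm n/0%MM]_(m <- s) m.

Definition strict_total_order_on G lt : Prop :=
  [/\ {in G, irreflexive lt},
      {in G & &, transitive lt} &
      {in G &, forall u v, u != v -> lt u v || lt v u}].

(* Minima are handled relationally: the empty set has no minimum, so the
   comparisons below fail when one of the sets involved is empty. *)
Definition is_min lt D u : Prop :=
  u \in D /\ forall v, v \in D -> v != u -> lt u v.

Definition lt_min lt u D : Prop := exists2 d, is_min lt D d & lt u d.

Definition min_lt_min lt C D : Prop := exists2 c, is_min lt C c & lt_min lt c D.

Definition is_cover G u C : bool :=
  [&& C `<=` G, u \in C & (u <= mlcms (C `\ u))%MM].

Definition E_minimal_cover G u C : Prop :=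
  is_cover G u C /\ forall C', C' `<` C -> ~~ is_cover G u C'.

Definition lcm_closure G D : {fset mon} := [fset w in G | (w <= mlcms D)%MM].

Definition broken G lt D : Prop :=
  [/\ D `<=` G, D != fset0 &
      exists u, [/\ u \in G, (u <= mlcms D)%MM & lt_min lt u D]].

Definition preserved G lt E : Prop :=
  E `<=` G /\ forall D, D `<=` E -> ~ broken G lt D.

End Covers.

Section Resolutions.
Variables (K : fieldType) (n : nat).
Local Notation R := {mpoly K[n]}.

(* A complex of finite free R-modules F_t with chosen bases,
     ... -> F_2 -> F_1 -> F_0 -> R,
   given by the images of the basis elements; [bdry t] is the differential
   F_(t+1) -> F_t, and [aug : F_0 -> R] is to be composed with R -> R/I. *)
Record based_complex := BasedComplex {
  basis : nat -> finType;
  bdry : forall t, basis t.+1 -> {ffun basis t -> R^o};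
  aug : basis 0 -> R }.

Variables (I : {pred R}) (F : based_complex).

Definition diff t (x : {ffun basis F t.+1 -> R^o}) : {ffun basis F t -> R^o} :=
  \sum_b x b *: bdry b.

Definition augmentation (x : {ffun basis F 0 -> R^o}) : R :=
  \sum_b x b * aug b.

(* Exactness of ... -> F_1 -> F_0 -> R/I -> 0. *)
Definition free_resolution : Prop :=
  [/\ forall r : R, exists x, augmentation x - r \in I,
      forall x, (augmentation x \in I) <-> exists y, x = diff (t := 0) y &
      forall t (x : {ffun basis F t.+1 -> R^o}),
        diff x = 0 <-> exists y, x = diff (t := t.+1) y].

(* diff F_(t+1) is contained in (x_1, ..., x_n) F_t. *)
Definition minimal_complex : Prop :=
  forall t (y : {ffun basis F t.+1 -> R^o}),
    exists z : 'I_n -> {ffun basis F t -> R^o},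
      diff y = \sum_(i < n) ('X_i : R) *: z i.

Definition minimal_free_resolution : Prop :=
  free_resolution /\ minimal_complex.

End Resolutions.

Section Lyubeznik.
Variables (K : fieldType) (n : nat).
Local Notation R := {mpoly K[n]}.
Local Notation mon := 'X_{1..n}.

Section Complex.
Variables (G : {fset mon}) (lt : rel mon).

Definition generator_seq : seq mon :=
  sort (fun u v => (u == v) || lt u v) (enum_fset G).

Local Notation mu := (size generator_seq).

Definition gen (i : 'I_mu) : mon := nth 0%MM generator_seq i.

Definition symbol_lcm (s : seq 'I_mu) : mon := mlcms [seq gen i | i <- s].

(* Positions in a symbol (i_1; ...; i_t) are numbered from 0 here. *)
Definition L_admissible t (s : t.-tuple 'I_mu) : bool :=
  sorted (fun i j : 'I_mu => (i < j)%N) s &&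
  [forall h : 'I_t, (h.+1 < t)%N ==>
    [forall q : 'I_mu, (q < tnth s h)%N ==>
      ~~ (gen q <= symbol_lcm (drop h s))%MM]].

Definition L_symbol t : finType := {s : t.-tuple 'I_mu | L_admissible s}.

Definition delete_at (T : Type) (j : nat) (s : seq T) : seq T :=
  take j s ++ drop j.+1 s.

(* The coefficient of the symbol r in the differential of the symbol s; each r
   arises from at most one j, and deleting an entry preserves admissibility. *)
Definition L_bdry t (s : L_symbol t.+1) : {ffun L_symbol t -> R^o} :=
  [ffun r : L_symbol t =>
     \sum_(j < t.+1 | delete_at j (val s) == val r :> seq _)
       (-1) ^+ j * 'X_[symbol_lcm (val s) - symbol_lcm (delete_at j (val s))]].

(* L_symbol 0 consists of the empty symbol only, which is mapped to 1. *)
Definition Lyubeznik_complex : based_complex K n :=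
  BasedComplex L_bdry (fun _ => 1).

End Complex.

Definition Lyubeznik_ideal (I : {pred R}) : Prop :=
  exists2 lt : rel mon, strict_total_order_on (min_generators I) lt &
    minimal_free_resolution I (Lyubeznik_complex (min_generators I) lt).

End Lyubeznik.

(* Main.v *)
From Stdlib Require Import Classical.
Require Import Defs.
From mathcomp Require Import all_boot all_order all_algebra.
From mathcomp Require Import finmap.
From mathcomp Require Import mpoly.

Set Implicit Arguments.
Unset Strict Implicit.
Unset Printing Implicit Defensive.

Import GRing.Theory.

Local Open Scope ring_scope.
Local Open Scope fset_scope.

(** The Lyubeznik complex is a resolution for every total order on [G(I)], so
    that [I] is a Lyubeznik ideal exactly when some order makes the complex
    minimal; and minimality says that no preserved set is a cover.

    Admissible symbols are the sets of generators that are preserved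
    ([L_admissibleP], [unbroken_preserved]), so a symbol is handled as a set of
    indices of generators. Both facts above are then read off multidegree by
    multidegree. The part of multidegree [m] of a chain is a scalar function on
    sets of indices, its [strand], and the differential acts on strands as a
    simplicial boundary ([strand_diff]).

    For exactness, let [q] be the least generator dividing [m]. Adding [q] to a
    preserved set whose lcm divides [m] gives a preserved set of the same kind
    ([unbrokenU1]), so the complex of sets in multidegree [m] is a cone with apex
    [q], and coning a cycle from [q] fills it ([set_bd_cone], [diff_filling]).

    For minimality, a differential has a nonzero constant coefficient exactly
    when some [u] can be deleted from a preserved set without changing its lcm,
    which makes this set a cover of [u] ([minimal_complexP],
    [minimal_complex_covers]).

    What remains is combinatorics. A cover that is not preserved contains a set
    [D] broken by some [w]. This [w] lies below all of [D], hence outside [D], so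
    [D] together with [w] is a cover of [w] ([broken_cover]), and it can be shrunk
    to an E-minimal one ([broken_E_minimal_cover]). Conversely, a set [D] such that
    the least new element of its closure precedes its minimum is broken
    ([min_lt_min_broken]). *)

(** * Monomials and monomial ideals *)

Section Monomials.
Variable n : nat.
Implicit Types (s : seq 'X_{1..n}) (u v m : 'X_{1..n}).

Lemma lepm_anti u v : (u <= v)%MM -> (v <= u)%MM -> u = v.
Proof.
move=> /mnm_lepP le_uv /mnm_lepP le_vu; apply/mnmP => i.
by apply/eqP; rewrite eqn_leq le_uv le_vu.
Qed.

Lemma subm_self m : (m - m)%MM = 0%MM.
Proof. by apply/mnmP => i; rewrite mnmBE mnm0E subnn. Qed.

Lemma mlcms_le s m : (mlcms s <= m)%MM = all (fun u => (u <= m)%MM) s.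
Proof.
elim: s => [|u s IHs]; first by rewrite /mlcms big_nil; apply/mnm_lepP => i; rewrite mnm0E.
by rewrite /mlcms big_cons lem_mlcm /= -IHs.
Qed.

Lemma mlcmsP s m : reflect {in s, forall u, (u <= m)%MM} (mlcms s <= m)%MM.
Proof. by rewrite mlcms_le; apply: allP. Qed.

Lemma le_mlcms s u : u \in s -> (u <= mlcms s)%MM.
Proof. by move: u; apply/mlcmsP/lepm_refl. Qed.

Lemma mlcms_sub s1 s2 : {subset s1 <= s2} -> (mlcms s1 <= mlcms s2)%MM.
Proof. by move=> sub12; apply/mlcmsP => u /sub12/le_mlcms. Qed.

End Monomials.

Section MonomialIdealMembership.
Variables (K : fieldType) (n : nat).
Local Notation R := {mpoly K[n]}.
Implicit Types (f : R) (S : 'X_{1..n} -> Prop) (I : {pred R}).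

Lemma mcoeff_mulX f (a m : 'X_{1..n}) :
  (f * 'X_[a])@_m = if (a <= m)%MM then f@_(m - a) else 0.
Proof.
case: ifPn => [le_am|nle_am]; first by rewrite -{1}(submK le_am) addmC mcoeffMX.
apply/eqP; rewrite mcoeff_eq0 (perm_mem (msuppMX _ _)).
by apply: contra nle_am => /mapP[b _ ->]; apply: lem_addr.
Qed.

(** Terms may cancel in a combination, but a surviving monomial comes from a
    single summand; hence membership is decided on the support alone. *)
Lemma in_monomial_spanP S f :
  in_monomial_span S f <->
  forall a, a \in msupp f -> exists2 u, S u & (u <= a)%MM.
Proof.
split=> [[c cS ->] a|Sf].
  rewrite mcoeff_msupp raddf_sum /= => nz.
  have [p pc] : exists2 p, p \in c & (p.1 * 'X_[p.2])@_a != 0.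
    apply/hasP; apply: contraNT nz => /hasPn c0.
    by rewrite big_seq big1 // => p /c0; rewrite negbK => /eqP.
  rewrite mcoeff_mulX; case: ifP => [le_pa _|_]; last by rewrite eqxx.
  by exists p.2 => //; apply: cS.
rewrite (mpolyE f); elim: (msupp f) Sf => [|a s IHs] Ss.
  by exists [::]; rewrite ?big_nil.
have [|c cS eq_c] := IHs; first by move=> b bs; apply: Ss; rewrite inE bs orbT.
have [|u Su le_ua] := Ss a; first by rewrite inE eqxx.
exists ((f@_a *: 'X_[a - u], u) :: c) => [p|].
  by rewrite inE => /orP[/eqP->|/cS].
by rewrite !big_cons eq_c /= -scalerAl -mpolyXD submK.
Qed.

(** If [u] properly divided [v], then [v] would be a multiple of [u] and could be
    dropped from the generators. *)
Lemma min_generators_antichain I G :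
  is_min_generators I G -> {in G &, forall u v, (u <= v)%MM -> u = v}.
Proof.
move=> [genG minG] u v uG vG le_uv; apply/eqP/idPn => neq_uv.
apply: (minG (G `\ v)); first by apply: fproperD1.
move=> f; rewrite genG !in_monomial_spanP; split=> Gf a /Gf[w wG le_wa].
  have [eq_wv|neq_wv] := eqVneq w v; last by exists w; rewrite // !inE neq_wv.
  by exists u; [rewrite !inE neq_uv|apply: lepm_trans le_uv _; rewrite -eq_wv].
by exists w => //; move: wG; rewrite !inE => /andP[].
Qed.

(** Minimality of a complex asks for coefficients in the ideal generated by the
    variables, which the constant term detects. *)
Lemma mcoeff0_eq0P f :
  f@_0%MM = 0 <-> exists z : 'I_n -> R, f = \sum_i 'X_i * z i.
Proof.
split=> [f0|[z ->]]; last first.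
  rewrite raddf_sum big1 //= => i _; rewrite mulrC mcoeff_mulX.
  case: ifP => // /mnm_lepP/(_ i); by rewrite mnm1E eqxx mnm0E.
have [|c c_var ->] := (in_monomial_spanP (fun u => exists i, u = U_(i)%MM) f).2.
  move=> a; rewrite mcoeff_msupp => nz.
  have [/existsP[i ai]|/existsPn a0] := boolP [exists i, a i != 0%N].
    by exists U_(i)%MM; [exists i|rewrite lep1mP].
  have a_eq0 : a = 0%MM by apply/mnmP => i; have := a0 i; rewrite mnm0E negbK => /eqP.
  by rewrite a_eq0 f0 eqxx in nz.
exists (fun i => \sum_(p <- c | p.2 == U_(i)%MM) p.1).
under [RHS]eq_bigr do rewrite mulr_sumr.
rewrite (exchange_big_dep xpredT) //=; apply: eq_big_seq => p pc.
have [i eq_i] := c_var p pc; rewrite (big_pred1 i) ?eq_i 1?mulrC // => j.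
by rewrite eq_mnm1 eq_sym.
Qed.

End MonomialIdealMembership.
(** * The boundary of functions on finite sets *)

Section SetComplex.
Local Open Scope ring_scope.
Variables (K : nzRingType) (N : nat).
Implicit Types (i k q : 'I_N) (A B : {set 'I_N}) (f g : {set 'I_N} -> K).

(** The exponent is the position of [i] in the increasing listing of [i |: A]. *)
Definition ins_sign i A : K := (-1) ^+ #|[set k in A | (k < i)%N]|.

(** The coefficient at [A] of the simplicial boundary of the chain in which each
    face [B] has coefficient [f B]. Summing over insertions into [A], rather than
    over deletions from [B], avoids listing faces as ordered tuples. *)
Definition set_bd f A : K := \sum_(i | i \notin A) ins_sign i A * f (i |: A).

Lemma eq_set_bd f g : f =1 g -> set_bd f =1 set_bd g.
Proof. by move=> eq_fg A; apply: eq_bigr => i _; rewrite eq_fg. Qed.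

Lemma ins_signU1 i k A : k \notin A ->
  ins_sign i (k |: A) = (if (k < i)%N then -1 else 1) * ins_sign i A.
Proof.
move=> kA; rewrite /ins_sign; case: ifP => lt_ki.
  have ->: [set j in k |: A | (j < i)%N] = k |: [set j in A | (j < i)%N].
    by apply/setP=> j; rewrite !inE; case: eqP => [->|].
  by rewrite cardsU1 !inE (negPf kA) exprS.
rewrite mul1r; congr (_ ^+ #|pred_of_set _|); apply/setP=> j.
by rewrite !inE; case: eqP => [->|//]; rewrite lt_ki !andbF.
Qed.

(** Inserting [i] then [k] and [k] then [i] give opposite signs. The terms with
    [i < k] are matched with those with [k < i], because a sum that is only known
    to equal its own opposite need not vanish in characteristic 2. *)
Lemma set_bd_bd f A : set_bd (set_bd f) A = 0.
Proof.
pose F (p : 'I_N * 'I_N) :=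
  ins_sign p.1 A * (ins_sign p.2 (p.1 |: A) * f (p.2 |: (p.1 |: A))).
pose P (p : 'I_N * 'I_N) := [&& p.1 \notin A, p.2 \notin A & p.2 != p.1].
rewrite /set_bd; under eq_bigr do rewrite mulr_sumr.
rewrite pair_big_dep /= (eq_bigl P) => [|[i k]]; last first.
  by rewrite /P !inE negb_or /=; case: (_ \in A); rewrite //= andbC.
rewrite -/(F _) (bigID (fun p : 'I_N * 'I_N => (p.1 < p.2)%N)) /=.
pose swap (p : 'I_N * 'I_N) := (p.2, p.1).
rewrite [X in _ + X](reindex_inj (h := swap)) /=; last by move=> [i k] [j l] [-> ->].
rewrite [X in _ + X](eq_bigl (fun p => P p && (p.1 < p.2)%N)); last first.
  move=> [i k]; rewrite /P /= [RHS]andbC andbC; case: (i \in A); case: (k \in A);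
    rewrite /= ?andbF //.
  rewrite -leqNgt; case: (eqVneq i k) => [->|neq_ik]; first by rewrite ltnn andbF.
  by rewrite !andbT ltn_neqAle (_ : (i : nat) != k).
rewrite -big_split /= big1 // => -[i k] /andP[/and3P[/= iA kA _] lt_ik].
rewrite /F /= !ins_signU1 // lt_ik ltnNge (ltnW lt_ik) /= mul1r setUCA.
rewrite mulN1r mulNr mulrN !mulrA addrC; apply/eqP; rewrite subr_eq0; apply/eqP.
congr (_ * _); rewrite /ins_sign -!exprD addnC //.
Qed.

Definition cone q f B : K := if q \in B then f (B :\ q) else 0.

(** When [q] is least among the vertices in the support of [f], inserting it has
    sign 1. At a set without [q] this insertion is the only term. At a set with [q],
    inserting anything else changes sign when [q] is removed, and the vanishing of
    the boundary at [A :\ q] turns the sum of these terms into [f A]. *)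
Lemma set_bd_cone q f A :
  (forall B k, f B != 0 -> k \in B -> (q <= k)%N) ->
  (q \in A -> set_bd f (A :\ q) = 0) ->
  set_bd (cone q f) A = f A.
Proof.
move=> f_ge bd0; have [qA|qA] := boolP (q \in A); last first.
  rewrite /set_bd (bigD1 q) //= big1 ?addr0 => [|i /andP[iA neq_iq]]; last first.
    by rewrite /cone !inE eq_sym (negPf neq_iq) (negPf qA) mulr0.
  rewrite /cone setU11 setU1K //; have [->|nz] := eqVneq (f A) 0; rewrite ?mulr0 //.
  rewrite /ins_sign (_ : [set _ in _ | _] = set0) ?cards0 ?mul1r //.
  apply/setP=> k; rewrite !inE; apply/negP=> /andP[kA].
  by rewrite ltnNge (f_ge _ _ nz kA).
have := bd0 qA; rewrite /set_bd (bigD1 q) /=; last by rewrite !inE eqxx.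
rewrite setD1K // (_ : ins_sign q _ * f A = f A); last first.
  have [->|nz] := eqVneq (f A) 0; rewrite ?mulr0 //.
  rewrite /ins_sign (_ : [set _ in _ | _] = set0) ?cards0 ?mul1r //.
  apply/setP=> k; rewrite !inE; apply/negP=> /andP[/andP[_ kA]].
  by rewrite ltnNge (f_ge _ _ nz kA).
move/eqP; rewrite addr_eq0 => /eqP->; rewrite -sumrN.
apply: eq_big => [i|i iA].
  by rewrite !inE; case: eqP => [->|]; rewrite ?qA //= andbT.
have neq_iq : i != q by apply: contraNneq iA => ->.
rewrite /cone !inE qA orbT (_ : (i |: A) :\ q = i |: (A :\ q)); last first.
  by apply/setP=> k; rewrite !inE; case: (eqVneq k i) => [->|//]; rewrite neq_iq.
set B := i |: _; have [->|nz] := eqVneq (f B) 0; first by rewrite !mulr0 oppr0.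
rewrite -mulNr -{1}(setD1K qA) ins_signU1 ?setD11 //.
rewrite ltn_neqAle (f_ge _ _ nz) ?setU11 // andbT.
by rewrite (_ : (q : nat) != i = true) ?mulN1r // eq_sym.
Qed.

End SetComplex.
(** * Admissible symbols as sets of generators *)

Section Generators.
Local Open Scope ring_scope.
Variables (n : nat) (G : {fset 'X_{1..n}}) (lt : rel 'X_{1..n}).
Hypothesis lt_total : strict_total_order_on G lt.
Hypothesis G_antichain : {in G &, forall u v, (u <= v)%MM -> u = v}.

Local Notation mu := (size (generator_seq G lt)).
Implicit Types (i j k q : 'I_mu) (A B D : {set 'I_mu}) (m u : 'X_{1..n}).

Lemma mem_gen i : gen i \in G.
Proof. by have := mem_nth 0%MM (ltn_ord i); rewrite mem_sort. Qed.

Lemma gen_onto u : u \in G -> exists i, gen i = u.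
Proof.
move=> uG; have us : u \in generator_seq G lt by rewrite mem_sort.
by exists (Ordinal (etrans (index_mem _ _) us)); rewrite /gen nth_index.
Qed.

Lemma gen_inj : injective (@gen n G lt).
Proof.
move=> i j /eqP; rewrite nth_uniq ?sort_uniq ?fset_uniq //.
by move/eqP/val_inj.
Qed.

Lemma lt_genE i j : lt (gen i) (gen j) = (i < j)%N.
Proof.
have [lt_irr lt_tr lt_tot] := lt_total.
have inG : all (mem G) (generator_seq G lt).
  by apply/allP => u; rewrite mem_sort.
pose le := fun u v => (u == v) || lt u v.
have le_tr : {in G & &, transitive le}.
  move=> v u w vG uG wG; rewrite /le.
  case: eqP => [->//|_] /= lt_uv; case: eqP => [<-|_ /= lt_vw]; first by rewrite lt_uv orbT.
  by rewrite (lt_tr v) ?orbT.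
have le_tot : {in G &, total le}.
  move=> u v uG vG; rewrite /le.
  by case: (eqVneq u v) => [->|neq_uv]; rewrite ?eqxx //= lt_tot.
have sorted_gen : sorted le (generator_seq G lt).
  by apply: (sort_sorted_in le_tot); apply/allP.
have homo (k l : 'I_mu) : (k < l)%N -> lt (gen k) (gen l).
  move=> lt_kl.
  have := sorted_ltn_nth_in le_tr 0%MM inG sorted_gen k l (ltn_ord k) (ltn_ord l) lt_kl.
  rewrite -/(gen k) -/(gen l) /le (inj_eq gen_inj).
  by case: eqP => // eq_kl; rewrite eq_kl ltnn in lt_kl.
apply/idP/idP => [lt_ij|/homo//]; rewrite ltnNge leq_eqVlt; apply/negP.
case/orP => [/eqP/val_inj eq_ij|/homo lt_ji].
  by have := lt_irr _ (mem_gen i); rewrite eq_ij in lt_ij *; rewrite lt_ij.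
have := lt_tr _ _ _ (mem_gen j) (mem_gen i) (mem_gen i) lt_ij lt_ji.
by rewrite lt_irr ?mem_gen.
Qed.

Definition set_lcm A : 'X_{1..n} := symbol_lcm (enum A).

Lemma set_lcmP A m : reflect {in A, forall i, (gen i <= m)%MM} (set_lcm A <= m)%MM.
Proof.
apply: (iffP (mlcmsP _ _)) => [le_m i iA|le_m _ /mapP[i iA ->]].
  by apply: le_m; rewrite map_f ?mem_enum.
by apply: le_m; rewrite mem_enum in iA.
Qed.

Lemma gen_le_set_lcm A i : i \in A -> (gen i <= set_lcm A)%MM.
Proof. by move: i; apply/set_lcmP/lepm_refl. Qed.

Lemma set_lcmS A B : A \subset B -> (set_lcm A <= set_lcm B)%MM.
Proof. by move=> /subsetP sAB; apply/set_lcmP => i /sAB/gen_le_set_lcm. Qed.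

Lemma symbol_lcmE (s : seq 'I_mu) : symbol_lcm s = set_lcm [set i in s].
Proof.
by apply: lepm_anti; apply: mlcms_sub => u /mapP[i];
  rewrite ?mem_enum ?inE => si ->; rewrite map_f ?mem_enum ?inE.
Qed.

(** The condition that the generators with index in [A] form a preserved set,
    transported to indices; [unbroken_preserved] is the comparison. *)
Definition unbroken A : Prop := forall D q, D \subset A -> D != set0 ->
  {in D, forall i, (q < i)%N} -> ~~ (gen q <= set_lcm D)%MM.

Lemma unbrokenS A B : A \subset B -> unbroken B -> unbroken A.
Proof. by move=> sAB unB D q /subset_trans/(_ sAB); apply: unB. Qed.

(** With [q] the least generator dividing [m], nothing below [q] divides the lcm of
    a set containing [q], and a set without [q] lies in [A]. *)
Lemma unbrokenU1 A q m : unbroken A ->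
  (gen q <= m)%MM -> (set_lcm A <= m)%MM ->
  (forall k, (gen k <= m)%MM -> (q <= k)%N) -> unbroken (q |: A).
Proof.
move=> unA le_qm le_Am q_min D k sDqA D0 lt_kD.
have [qD|qD] := boolP (q \in D).
  apply: contraL (lt_kD _ qD) => le_kD; rewrite -leqNgt; apply: q_min.
  apply: lepm_trans le_kD _; apply/set_lcmP => i /(subsetP sDqA).
  by rewrite !inE => /orP[/eqP->//|]; apply: (set_lcmP _ _ le_Am).
apply: unA => //; apply/subsetP => i iD; have := subsetP sDqA i iD.
by rewrite !inE; case: eqP iD => // ->; rewrite (negPf qD).
Qed.

Lemma min_in_set D : D != set0 -> exists2 i, i \in D & {in D, forall k, (i <= k)%N}.
Proof.
by case/set0Pn => i0 i0D; case: (arg_minnP (fun i : 'I_mu => i : nat) i0D) => i; exists i.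
Qed.

(** Admissibility only tests the tails of a symbol. This is enough: if [q] breaks
    [D], it breaks the tail that starts at the least element of [D], since the lcm
    of that tail is a multiple of the lcm of [D]. The tail reduced to the last entry
    is not tested, and there the antichain property applies. *)
Lemma L_admissibleP t (s : t.-tuple 'I_mu) :
  reflect (sorted (fun i j : 'I_mu => (i < j)%N) s /\ unbroken [set i in s])
    (L_admissible s).
Proof.
have ltS_tr : transitive (fun i j : 'I_mu => (i < j)%N).
  by move=> j i k; apply: ltn_trans.
apply: (iffP andP) => -[s_sorted adm]; split=> //.
  move=> D q sDs D0 lt_qD; have [d dD d_min] := min_in_set D0.
  have /tnthP[h eq_dh] : d \in s by have := subsetP sDs d dD; rewrite inE.
  apply/negP => le_qD; have lt_qh : (q < tnth s h)%N by rewrite -eq_dh; apply: lt_qD.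
  have D_tail i : i \in D -> i \in drop h s.
    move=> iD; have /tnthP[j eq_ij] : i \in s by have := subsetP sDs i iD; rewrite inE.
    have le_hj : (h <= j)%N.
      rewrite leqNgt; apply/negP => lt_jh; have := d_min _ iD; apply/negP; rewrite -ltnNge.
      rewrite eq_ij eq_dh !(tnth_nth d).
      by apply: (sorted_ltn_nth ltS_tr) => //; rewrite inE size_tuple.
    rewrite eq_ij (tnth_nth d) -(subnKC le_hj) -nth_drop mem_nth //.
    by rewrite size_drop size_tuple ltn_sub2r // (leq_ltn_trans le_hj).
  have le_qt : (gen q <= symbol_lcm (drop h s))%MM.
    apply: lepm_trans le_qD _; rewrite symbol_lcmE; apply: set_lcmS.
    by apply/subsetP => i /D_tail; rewrite inE.
  have := implyP (forallP adm h); case: (ltnP h.+1 t) => [_|le_th] /=.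
    by move=> /(_ isT)/forallP/(_ q); rewrite lt_qh le_qt.
  have eq_drop : drop h s = [:: d].
    rewrite (drop_nth d) ?size_tuple // -tnth_nth eq_dh drop_oversize //.
    by rewrite size_tuple.
  move: le_qt; rewrite eq_drop symbol_lcmE => /lepm_trans/(_ (_ : _ <= gen d)%MM) le_qd.
  have eq_qd : q = d.
    apply: gen_inj; apply: G_antichain; rewrite ?mem_gen //; apply: le_qd.
    by apply/set_lcmP => i; rewrite !inE => /eqP->; apply: lepm_refl.
  by have := lt_qD _ dD; rewrite eq_qd ltnn.
apply/forallP => h; apply/implyP => _; apply/forallP => q; apply/implyP => lt_qh.
rewrite symbol_lcmE; have eq_drop : drop h s = tnth s h :: drop h.+1 s.
  by rewrite (drop_nth (tnth s h)) ?size_tuple // -tnth_nth.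
apply: adm => [||i].
- by apply/subsetP => i; rewrite !inE; apply: mem_drop.
- by apply/set0Pn; exists (tnth s h); rewrite inE eq_drop mem_head.
have := drop_sorted h s_sorted; rewrite inE eq_drop /= => /(order_path_min ltS_tr)/allP tail.
by rewrite inE => /orP[/eqP->//|/tail]; apply: ltn_trans.
Qed.

Local Notation symbol t := (L_symbol G lt t).

Definition symbol_set t (s : symbol t) : {set 'I_mu} := [set i in val s].

Lemma symbol_sorted t (s : symbol t) :
  sorted (fun i j : 'I_mu => (i < j)%N) (val s).
Proof. by have /L_admissibleP[] := valP s. Qed.

Lemma symbol_unbroken t (s : symbol t) : unbroken (symbol_set s).
Proof. by have /L_admissibleP[] := valP s. Qed.

Lemma symbol_uniq t (s : symbol t) : uniq (val s).
Proof.
apply: (@sorted_uniq _ (fun i j : 'I_mu => (i < j)%N)) (symbol_sorted s).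
  by move=> j i k; apply: ltn_trans.
by move=> i; rewrite /= ltnn.
Qed.

Lemma card_symbol_set t (s : symbol t) : #|symbol_set s| = t.
Proof. by rewrite cardsE (card_uniqP (symbol_uniq s)) size_tuple. Qed.

Lemma symbol_set_inj t : injective (@symbol_set t).
Proof.
move=> r s eq_rs; apply/val_inj/val_inj => /=.
apply: (@irr_sorted_eq _ (fun i j : 'I_mu => (i < j)%N)); rewrite ?symbol_sorted //.
- by move=> j i k; apply: ltn_trans.
- by move=> i; rewrite /= ltnn.
by move=> i; have /setP/(_ i) := eq_rs; rewrite !inE.
Qed.

Lemma symbol_set_onto t A : unbroken A -> #|A| = t -> exists s : symbol t, symbol_set s = A.
Proof.
move=> unA cardA; have sizeA : size (enum A) == t by rewrite -cardE cardA.
have sortedA : sorted (fun i j : 'I_mu => (i < j)%N) (enum A).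
  rewrite /enum_mem; apply: sorted_filter; first by move=> j i k; apply: ltn_trans.
  by have := iota_ltn_sorted 0 mu; rewrite -val_enum_ord sorted_map -enumT.
have eq_A : [set i in Tuple sizeA] = A by apply/setP => i; rewrite inE mem_enum.
have admA : L_admissible (Tuple sizeA) by apply/L_admissibleP; rewrite eq_A.
by exists (exist (fun s : t.-tuple 'I_mu => L_admissible s) _ admA).
Qed.

(** Turns the deletions of the Lyubeznik differential into the insertions of
    [set_bd]. *)
Lemma delete_at_eq t (s : symbol t.+1) (r : symbol t) (j : 'I_t.+1) :
  (delete_at j (val s) == val r :> seq _) =
  (tnth (val s) j \notin symbol_set r) &&
  (tnth (val s) j |: symbol_set r == symbol_set s).
Proof.
have jt : (j < size (val s))%N by rewrite size_tuple.
have eq_s : val s = take j (val s) ++ tnth (val s) j :: drop j.+1 (val s) :> seq _.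
  rewrite -{1}(cat_take_drop j (val s)); congr (_ ++ _).
  by rewrite (tnth_nth (tnth (val s) j)) -drop_nth.
have mem_s i : (i \in symbol_set s) =
    [|| i \in take j (val s), i == tnth (val s) j | i \in drop j.+1 (val s)].
  by rewrite inE -[LHS]/(i \in tval (val s)) [X in i \in X]eq_s mem_cat inE.
have := symbol_uniq s; rewrite {1}eq_s cat_uniq /= negb_or -!andbA.
case/and5P=> uniq_take take_j disj drop_j uniq_drop.
apply/eqP/andP => [eq_r|[j_r /eqP eq_sr]].
  have mem_r i : (i \in symbol_set r) = (i \in delete_at j (val s)) by rewrite inE eq_r.
  split; first by rewrite mem_r mem_cat negb_or take_j drop_j.
  apply/eqP/setP => i; rewrite in_setU1 mem_r mem_s mem_cat.
  by rewrite orbCA.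
have sorted_del : sorted (fun i k : 'I_mu => (i < k)%N) (delete_at j (val s)).
  apply: (subseq_sorted _ _ (symbol_sorted s)); first by move=> k i l; apply: ltn_trans.
  by rewrite [X in subseq _ X]eq_s cat_subseq // subseq_cons.
apply: (@irr_sorted_eq _ (fun i k : 'I_mu => (i < k)%N)); rewrite ?symbol_sorted //.
- by move=> k i l; apply: ltn_trans.
- by move=> i; rewrite /= ltnn.
move=> i; have /setP/(_ i) := eq_sr.
rewrite in_setU1 mem_s mem_cat => eq_i; move: eq_i; rewrite inE.
have [->|_] := eqVneq i (tnth (val s) j); last by [].
by move=> _; rewrite (negPf take_j) (negPf drop_j); move: j_r; rewrite inE => /negPf->.
Qed.

(** The position of an entry of a symbol is the exponent in [ins_sign]. *)
Lemma card_lt_tnth t (s : symbol t) (j : 'I_t) :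
  #|[set k in symbol_set s | (k < tnth (val s) j)%N]| = j.
Proof.
have lt_tr : transitive (fun i j : 'I_mu => (i < j)%N).
  by move=> k i l; apply: ltn_trans.
have lt_js : (j < size (val s))%N by rewrite size_tuple.
have -> : [set k in symbol_set s | (k < tnth (val s) j)%N] = [set k in take j (val s)].
  apply/setP => k; rewrite !inE; apply/andP/idP => [[/tnthP[l eq_k]]|ks].
    rewrite eq_k !(tnth_nth k) => lt_lj; have {}lt_lj : (l < j)%N.
      rewrite ltnNge; apply: contraL lt_lj => le_jl; rewrite -leqNgt.
      move: le_jl; rewrite leq_eqVlt => /orP[/eqP->//|lt_jl]; apply: ltnW.
      by apply: (sorted_ltn_nth lt_tr _ (symbol_sorted s)); rewrite ?inE ?size_tuple.
    by rewrite -(nth_take _ lt_lj) mem_nth // size_take lt_js.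
  have /(nthP k)[l] := ks; rewrite size_take lt_js => lt_lj.
  rewrite nth_take // => <-; rewrite mem_nth ?(ltn_trans lt_lj) //; split=> //.
  rewrite (tnth_nth k).
  by apply: (sorted_ltn_nth lt_tr _ (symbol_sorted s)); rewrite // inE (ltn_trans lt_lj).
rewrite cardsE (card_uniqP _) ?size_take ?lt_js //.
by apply: take_uniq; apply: symbol_uniq.
Qed.

(** * Multigraded strands of the Lyubeznik complex *)

Variable K : fieldType.
Local Notation R := {mpoly K[n]}.
Local Notation chain t := {ffun symbol t -> R^o}.

(** The part of multidegree [m] of a chain: the coefficient of the monomial
    multiple of the symbol [A] that has multidegree [m]. At most one symbol
    contributes to the sum, and none when [A] is not admissible of dimension [t]. *)
Definition strand t m (x : chain t) A : K :=
  \sum_(s | symbol_set s == A) if (set_lcm A <= m)%MM then (x s)@_(m - set_lcm A) else 0.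

Lemma strandE t m (x : chain t) (s : symbol t) :
  strand m x (symbol_set s) =
  if (set_lcm (symbol_set s) <= m)%MM then (x s)@_(m - set_lcm (symbol_set s)) else 0.
Proof. by rewrite /strand (big_pred1 s) // => r; rewrite (inj_eq (@symbol_set_inj t)). Qed.

Lemma strand_neq0 t m (x : chain t) A : strand m x A != 0 ->
  [/\ unbroken A, #|A| = t & (set_lcm A <= m)%MM].
Proof.
have [/existsP[s /eqP <-]|noA] := boolP [exists s : symbol t, symbol_set s == A].
  rewrite strandE; case: ifP => [le_sm _|_]; last by rewrite eqxx.
  by split; [apply: symbol_unbroken|apply: card_symbol_set|].
rewrite /strand big_pred0 ?eqxx // => s; apply: contraNF noA => sA.
by apply/existsP; exists s.
Qed.

Lemma strand_inj t (x y : chain t) :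
  (forall m (s : symbol t), strand m x (symbol_set s) = strand m y (symbol_set s)) -> x = y.
Proof.
move=> eq_xy; apply/ffunP => s; apply/mpolyP => a.
have := eq_xy (a + set_lcm (symbol_set s))%MM s.
by rewrite !strandE lem_addl addmK.
Qed.

Lemma strand0 t m A : strand m (0 : chain t) A = 0.
Proof. by rewrite /strand big1 // => s _; rewrite ffunE mcoeff0 if_same. Qed.

Lemma mcoeff_sign_mul (p : R) (b : nat) a : ((-1) ^+ b * p)@_a = (-1) ^+ b * p@_a.
Proof. 
elim: b => [|b IHb]; first by rewrite !expr0 !mul1r.
by rewrite !exprS -!mulrA !mulN1r mcoeffN IHb. Qed.

Lemma diffE t (x : chain t.+1) (r : symbol t) :
  diff (F := Lyubeznik_complex K G lt) x r = \sum_s x s * L_bdry K s r.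
Proof. by rewrite /diff sum_ffunE; apply: eq_bigr => s _; rewrite ffunE. Qed.

(** The differential preserves multidegrees, because the monomial
    lcm([s]) / lcm([r]) shifts degrees by what the symbol loses. In a fixed
    multidegree only the signs remain. *)
Lemma strand_diff t m (x : chain t.+1) A :
  strand m (diff (F := Lyubeznik_complex K G lt) x : chain t) A = set_bd (strand m x) A.
Proof.
have [/existsP[r /eqP <-]|noA] := boolP [exists r : symbol t, symbol_set r == A]; last first.
  rewrite /strand big_pred0 => [|r]; last first.
    by apply: contraNF noA => rA; apply/existsP; exists r.
  rewrite /set_bd big1 // => i iA; apply/eqP; rewrite mulf_eq0; apply/orP; right.
  apply: contraNT noA => /strand_neq0[un_iA card_iA _].
  have [|r rA] := @symbol_set_onto t A (unbrokenS (subsetU1 _ _) un_iA).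
    by move: card_iA; rewrite cardsU1 iA add1n => -[].
  by apply/existsP; exists r; rewrite rA.
set B := symbol_set r; rewrite strandE -/B.
(* Insertions into [B] are grouped by the symbol that they produce. *)
transitivity (\sum_(s : symbol t.+1) \sum_(i | (i \notin B) && (i |: B == symbol_set s))
    ins_sign K i B * strand m x (symbol_set s)); last first.
  rewrite (exchange_big_dep (fun i => i \notin B)) /=; last by move=> s i _ /andP[].
  apply: eq_bigr => i iB; rewrite (eq_bigl (fun s => symbol_set s == i |: B)); last first.
    by move=> s; rewrite iB eq_sym.
  rewrite -big_distrr /=; congr (_ * _); apply: eq_bigr => s /eqP eq_s.
  by rewrite -eq_s strandE.
have bd_coef (s : symbol t.+1) : (set_lcm B <= m)%MM ->
   (x s * L_bdry K s r)@_(m - set_lcm B) =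
   \sum_(i | (i \notin B) && (i |: B == symbol_set s)) ins_sign K i B * strand m x (symbol_set s).
  move=> le_Bm; rewrite [RHS](eq_bigl (fun i =>
      (i \in val s) && ((i \notin B) && (i |: B == symbol_set s)))); last first.
    move=> i; case: (altP (i |: B =P _)) => [eq_s|]; rewrite ?andbF // andbT.
    by have := setU11 i B; rewrite eq_s inE => ->.
  rewrite big_mkcondr /= -(big_uniq _ (symbol_uniq s)) big_tuple ffunE mulr_sumr.
  rewrite raddf_sum big_mkcond /=; apply: eq_bigr => j _.
  rewrite delete_at_eq -/B; case: ifP => // /andP[jB /eqP eq_s].
  have del_lcm : symbol_lcm (delete_at j (val s)) = set_lcm B.
    have /eqP-> : delete_at j (val s) == val r :> seq _ by rewrite delete_at_eq jB eq_s /=.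
    by rewrite symbol_lcmE.
  have le_Bs : (set_lcm B <= set_lcm (symbol_set s))%MM by rewrite -eq_s set_lcmS ?subsetU1.
  rewrite mulrCA mcoeff_sign_mul mcoeff_mulX del_lcm symbol_lcmE -/(symbol_set s) strandE.
  congr (_ * _).
    rewrite /ins_sign -[in LHS](card_lt_tnth s j) -eq_s; congr (_ ^+ #|pred_of_set _|).
    apply/setP=> k; rewrite !inE; case: eqP => [->|//].
    by rewrite ltnn !andbF.
  set L := set_lcm (symbol_set s) in le_Bs *; set M := set_lcm B in le_Bm le_Bs *.
  have -> : (L - M <= m - M)%MM = (L <= m)%MM.
    apply/mnm_lepP/mnm_lepP => le_Lm i; have := le_Lm i; 
      by rewrite !mnmBE leq_sub2rE //; apply: (mnm_lepP le_Bm).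
  case: ifP => // _; congr (_@__); apply/mnmP => i; rewrite !mnmBE.
  by rewrite subnBA ?subnK //; [apply: (mnm_lepP le_Bm)|apply: (mnm_lepP le_Bs)].
rewrite diffE raddf_sum /=; case: ifP => [le_Bm|nle_Bm].
  by apply: eq_bigr => s _; apply: bd_coef.
rewrite big1 // => s _; rewrite big1 // => i /andP[_ /eqP eq_s].
rewrite -eq_s; set f := strand _ _ _; have [->|nz] := eqVneq f 0; first by rewrite mulr0.
have [_ _ /(lepm_trans (set_lcmS (subsetU1 i B)))] := strand_neq0 nz.
by rewrite nle_Bm.
Qed.

(** * Exactness *)

Definition is_apex m q := (gen q <= m)%MM && [forall k : 'I_mu, (gen k <= m)%MM ==> (q <= k)%N].

Lemma apexP m i : (gen i <= m)%MM -> exists q, is_apex m q.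
Proof.
move=> le_im.
have [q le_qm q_min] := @arg_minnP _ i (fun k => gen k <= m)%MM (fun k => k : nat) le_im.
by exists q; rewrite /is_apex le_qm; apply/forallP => k; apply/implyP/q_min.
Qed.

(** The apex depends on the multidegree, so chains are coned separately in each
    multidegree; there is nothing to cone where no generator divides [m]. *)
Definition filling_coef t m (x : chain t) A : K :=
  if [pick q | is_apex m q] is Some q then cone q (strand m x) A else 0.

Lemma filling_coef_neq0 t m (x : chain t) A : filling_coef m x A != 0 ->
  [/\ unbroken A, #|A| = t.+1, (set_lcm A <= m)%MM
    & exists2 B, strand m x B != 0 & #|B| = t].
Proof.
rewrite /filling_coef; case: pickP => [q|_]; last by rewrite eqxx.
case/andP => le_qm /forallP q_min; rewrite /cone; case: ifP => [qA|_]; last by rewrite eqxx.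
move=> nz; have [unB cardB le_Bm] := strand_neq0 nz.
rewrite (cardsD1 q A) qA cardB -(setD1K qA); split=> //; last by exists (A :\ q)%SET.
  by apply: (unbrokenU1 (m := m)) => // k; apply/implyP.
apply/set_lcmP => i; rewrite !inE => /orP[/eqP->//|/andP[neq_iq iA]].
by apply: (set_lcmP _ _ le_Bm); rewrite !inE neq_iq.
Qed.

(** The multidegrees in which [x] lives. That they are finite in number makes the
    filling a chain with polynomial coefficients. *)
Definition multidegrees t (x : chain t) : seq 'X_{1..n} :=
  undup [seq (a + set_lcm (symbol_set s))%MM | s <- enum {: symbol t}, a <- msupp (x s)].

Lemma mem_multidegrees t (x : chain t) m A : strand m x A != 0 -> m \in multidegrees x.
Proof.
move=> nz; have [unA cardA le_Am] := strand_neq0 nz.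
have [s eq_s] := symbol_set_onto unA cardA; move: nz; rewrite -eq_s strandE eq_s le_Am => nz.
rewrite mem_undup; apply/allpairsPdep; exists s, (m - set_lcm A)%MM.
by rewrite mem_enum mcoeff_msupp nz eq_s submK.
Qed.

Definition filling t (x : chain t) : chain t.+1 :=
  [ffun s => \sum_(m <- multidegrees x)
     filling_coef m x (symbol_set s) *: 'X_[m - set_lcm (symbol_set s)]].

(** The summands of [filling x] at a symbol are monomials of distinct
    multidegrees, so each strand sees exactly one of them. *)
Lemma strand_filling t m (x : chain t) A : strand m (filling x) A = filling_coef m x A.
Proof.
have [/existsP[s /eqP <-]|noA] := boolP [exists s : symbol t.+1, symbol_set s == A]; last first.
  rewrite /strand big_pred0 => [|s]; last first.
    by apply: contraNF noA => sA; apply/existsP; exists s.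
  apply/esym/eqP; apply: contraNT noA => /filling_coef_neq0[unA cardA _ _].
  by have [s sA] := symbol_set_onto unA cardA; apply/existsP; exists s; rewrite sA.
rewrite strandE; set L := set_lcm _; case: ifP => [le_Lm|nle_Lm]; last first.
  by apply/esym/eqP; apply: contraFT nle_Lm => /filling_coef_neq0[].
rewrite ffunE raddf_sum /=.
transitivity (\sum_(d <- multidegrees x | d == m) filling_coef d x (symbol_set s)).
  rewrite [RHS]big_mkcond; apply: eq_bigr => d _; rewrite mcoeffZ mcoeffX -/L.
  have [->|neq_dm] := eqVneq d m; first by rewrite eqxx mulr1.
  set c := filling_coef _ _ _; have [->|nz] := eqVneq c 0; first by rewrite mul0r.
  have [_ _ le_Ld _] := filling_coef_neq0 nz.
  rewrite (_ : (_ == _) = false) ?mulr0 //; apply: contraNF neq_dm => /eqP eq_dm.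
  by rewrite -(submK le_Lm) -eq_dm submK.
set c := filling_coef m x _; have [c0|nz] := eqVneq c 0.
  by rewrite c0 big1 // => d /eqP->.
have [_ _ _ [B /mem_multidegrees mB _]] := filling_coef_neq0 nz.
by rewrite -big_filter filter_pred1_uniq ?undup_uniq // big_seq1.
Qed.

(** The boundary vanishes at sets of size [t - 1] when [x] is a cycle. For [t = 0]
    there are no such sets: the first condition alone then expresses that [x] lies
    in the ideal, which also settles the end of the complex. *)
Lemma diff_filling t (x : chain t) :
  (forall m A, strand m x A != 0 -> exists i, (gen i <= m)%MM) ->
  (forall m A, #|A|.+1 = t -> set_bd (strand m x) A = 0) ->
  x = diff (F := Lyubeznik_complex K G lt) (filling x).
Proof.
move=> x_div x_bd; apply: strand_inj => m r; rewrite strand_diff.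
rewrite (eq_set_bd (strand_filling m x)) /filling_coef; set A := symbol_set r.
have [q|no_apex] := pickP (is_apex m); last first.
  rewrite /set_bd big1 => [|i _]; last by rewrite mulr0.
  apply/eqP/negP => /negP /x_div[i /apexP[q]]; by rewrite no_apex.
move=> /andP[_ /forallP q_min]; rewrite set_bd_cone // => [B k nz kB|qA].
  have [_ _ le_Bm] := strand_neq0 nz; apply: (implyP (q_min k)).
  exact: (set_lcmP _ _ le_Bm).
by apply: x_bd; have := card_symbol_set r; rewrite (cardsD1 q) qA add1n.
Qed.

Lemma Lyubeznik_exact t (x : chain t.+1) :
  diff (F := Lyubeznik_complex K G lt) x = 0 <->
  exists y, x = diff (F := Lyubeznik_complex K G lt) (t := t.+1) y.
Proof.
split=> [dx0|[y ->]].
  exists (filling x); apply: diff_filling => [m A nz|m A _].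
    have [_ cardA le_Am] := strand_neq0 nz.
    have /card_gt0P[i iA] : (0 < #|A|)%N by rewrite cardA.
    by exists i; apply: (set_lcmP _ _ le_Am).
  by rewrite -strand_diff dx0 strand0.
apply: strand_inj => m s; rewrite strand0 strand_diff.
by rewrite (eq_set_bd (strand_diff m y)) set_bd_bd.
Qed.

(** In dimension 0 the chains are polynomials, placed at the empty symbol. Such a
    polynomial belongs to the ideal exactly when each of its monomials is divisible
    by a generator, which is the divisibility hypothesis of [diff_filling]. *)
Lemma Lyubeznik_resolution (I : {pred R}) :
  generates (fun u => u \in G) I -> free_resolution I (Lyubeznik_complex K G lt).
Proof.
move=> genI.
have [s0 s0E] : exists s0 : symbol 0, forall s, s = s0.
  have un0 : unbroken set0 by move=> D q; rewrite subset0 => /eqP->; rewrite eqxx.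
  have [s0 _] := symbol_set_onto un0 (cards0 _); exists s0 => s.
  by apply: symbol_set_inj; rewrite !(cards0_eq (card_symbol_set _)).
have augE (x : chain 0) : augmentation (F := Lyubeznik_complex K G lt) x = x s0.
  rewrite /augmentation (big_pred1 s0) ?mulr1 // => s.
  exact/esym/eqP/s0E.
split=> [f|x|t x]; last exact: Lyubeznik_exact.
  exists [ffun=> f]; rewrite augE ffunE subrr; apply/genI/in_monomial_spanP => a.
  by rewrite msupp0.
rewrite augE genI in_monomial_spanP; split=> [x_div|[y ->] a].
  exists (filling x); apply: diff_filling => // m A nz.
  have [unA cardA le_Am] := strand_neq0 nz; have [s eq_s] := symbol_set_onto unA cardA.
  move: nz; rewrite -eq_s strandE eq_s le_Am [s]s0E -mcoeff_msupp => /x_div[u uG le_u].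
  have [i eq_u] := gen_onto uG; exists i; rewrite eq_u; apply: lepm_trans le_u _.
  exact: lem_subr.
rewrite mcoeff_msupp => nz.
have lcm0 : set_lcm (symbol_set s0) = 0%MM.
  apply: lepm_anti; last by apply/mnm_lepP => i; rewrite mnm0E.
  by apply/set_lcmP => i; rewrite (cards0_eq (card_symbol_set s0)) inE.
have : strand a (diff (F := Lyubeznik_complex K G lt) y : chain 0) (symbol_set s0) != 0.
  rewrite strandE lcm0 -{1}[a]addm0 lem_addl.
  by rewrite (_ : a - 0 = a)%MM //; apply/mnmP => i; rewrite mnmBE mnm0E subn0.
rewrite strand_diff /set_bd => bd_nz.
have [i _] : exists2 i, i \notin symbol_set s0 & strand a y (i |: symbol_set s0) != 0.
  apply/exists_inP; apply: contraNT bd_nz => /exists_inPn all0.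
  by rewrite big1 // => i /all0; rewrite negbK => /eqP->; rewrite mulr0.
move=> /strand_neq0[_ _ le_a]; exists (gen i); first exact: mem_gen.
by apply: (set_lcmP _ _ le_a); rewrite setU11.
Qed.

(** * Minimality *)

(** The constant term of the coefficient of [diff y] at a symbol [r] is the strand
    of multidegree lcm([r]). There [set_bd] only meets unbroken sets [i |: r] with
    the same lcm as [r], that is, unbroken sets covering one of their generators. *)
Lemma minimal_complexP : minimal_complex (Lyubeznik_complex K G lt) <->
  forall A i, unbroken A -> i \in A -> ~~ (gen i <= set_lcm (A :\ i))%MM.
Proof.
split=> [min_L A i unA iA|no_cover t y].
  apply/negP => le_i; set B := (A :\ i)%SET in le_i.
  have [t cardB] : exists t, #|B| = t by exists #|B|.
  have cardA : #|A| = t.+1 by rewrite (cardsD1 i) iA -cardB.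
  have [s eq_s] := symbol_set_onto unA cardA.
  have [r eq_r] := @symbol_set_onto t B (unbrokenS (subsetDl _ _) unA) cardB.
  (* The symbol of [A] itself: its differential has coefficient 1 or -1 at [B]. *)
  pose y : chain t.+1 := [ffun s' => (s' == s)%:R].
  have [z eq_z] := min_L _ y.
  have /eqP := strand_diff (set_lcm (symbol_set r)) y (symbol_set r); apply/negP.
  rewrite strandE lepm_refl subm_self eq_r.
  rewrite (_ : _@__ = 0) ?[0 == _]eq_sym; last first.
    rewrite [diff _]eq_z; apply/mcoeff0_eq0P; exists (fun l => z l r).
    by rewrite sum_ffunE; apply: eq_bigr => l _; rewrite ffunE.
  have lcmA : set_lcm A = set_lcm B.
    apply: lepm_anti; last by rewrite set_lcmS ?subsetDl.
    apply/set_lcmP => k kA; have [->//|neq_ki] := eqVneq k i.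
    by rewrite gen_le_set_lcm // !inE neq_ki.
  rewrite /set_bd (bigD1 i) ?setD11 //= big1 => [|k /andP[_ neq_ki]].
    rewrite setD1K // -eq_s strandE eq_s lcmA lepm_refl subm_self ffunE eqxx.
    by rewrite mcoeff1 eqxx mulr1 addr0 /ins_sign signr_eq0.
  set f := strand _ _ _; have [->|nz] := eqVneq f 0; first by rewrite mulr0.
  have [un_kB card_kB _] := strand_neq0 nz; move: nz.
  have [s' eq_s'] := symbol_set_onto un_kB card_kB; rewrite /f -eq_s' strandE ffunE.
  have [eq_ss'|_] := eqVneq s' s; last by rewrite mcoeff0 if_same eqxx.
  have : i \in k |: B by rewrite -eq_s' eq_ss' eq_s.
  by rewrite !inE eq_sym (negPf neq_ki) eqxx.
suff /fin_all_exists[z zE] : forall r : symbol t, exists z : 'I_n -> R,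
    diff (F := Lyubeznik_complex K G lt) y r = \sum_l 'X_l * z l.
  exists (fun l => [ffun r => z r l]); apply/ffunP => r; rewrite zE sum_ffunE.
  by apply: eq_bigr => i _; rewrite !ffunE.
move=> r; apply/mcoeff0_eq0P.
have := strand_diff (set_lcm (symbol_set r)) y (symbol_set r).
rewrite strandE lepm_refl subm_self => ->; rewrite /set_bd big1 // => i ir.
set f := strand _ _ _; have [->|nz] := eqVneq f 0; first by rewrite mulr0.
have [un_ir _ le_ir] := strand_neq0 nz.
have := no_cover _ i un_ir (setU11 _ _); rewrite setU1K //.
by rewrite (set_lcmP _ _ le_ir) ?setU11.
Qed.

(** * Preserved sets and covers *)

Lemma min_exists (D : {fset 'X_{1..n}}) : D `<=` G -> D != fset0 -> exists d, is_min lt D d.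
Proof.
move=> /fsubsetP sDG /fset0Pn[v0 v0D]; have [i0 eq_i0] := gen_onto (sDG _ v0D).
have [|i iD i_min] := @min_in_set [set i | gen i \in D].
  by apply/set0Pn; exists i0; rewrite inE eq_i0.
rewrite inE in iD; exists (gen i).
split=> // v vD; have [k eq_k] := gen_onto (sDG _ vD); rewrite -eq_k in vD * => neq_ki.
rewrite lt_genE ltn_neqAle i_min ?inE // andbT.
by apply: contraNneq neq_ki => /val_inj->.
Qed.

(** Comparisons with the minimum become comparisons with every element, a form in
    which no minimum has to be named. *)
Lemma lt_min_all (D : {fset 'X_{1..n}}) u : D `<=` G -> u \in G ->
  lt_min lt u D <-> D != fset0 /\ {in D, forall v, lt u v}.
Proof.
have [lt_irr lt_tr lt_tot] := lt_total.
move=> /fsubsetP sDG uG; split=> [[d [dD d_min] lt_ud]|[/fset0Pn[v0 v0D] lt_uD]].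
  split=> [|v vD]; first by apply/fset0Pn; exists d.
  have [->//|neq_vd] := eqVneq v d.
  by apply: (lt_tr d); rewrite // ?sDG ?d_min.
have [d d_min] : exists d, is_min lt D d.
  by apply: min_exists; [apply/fsubsetP|apply/fset0Pn; exists v0].
by exists d => //; apply: lt_uD; case: d_min.
Qed.

Definition gen_set A : {fset 'X_{1..n}} := [fset gen i | i in A].

Lemma mem_gen_set A i : (gen i \in gen_set A) = (i \in A).
Proof. by rewrite mem_imfset //; apply: gen_inj. Qed.

Lemma gen_set_sub A : gen_set A `<=` G.
Proof. by apply/fsubsetP => _ /imfsetP[i _ ->]; apply: mem_gen. Qed.

Lemma gen_set_onto (C : {fset 'X_{1..n}}) : C `<=` G -> exists A, gen_set A = C.
Proof.
move=> /fsubsetP sCG; exists [set i | gen i \in C]; apply/fsetP => u.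
apply/imfsetP/idP => [[i /= + ->]|uC]; first by rewrite inE.
by have [i eq_u] := gen_onto (sCG _ uC); exists i; rewrite //= inE eq_u.
Qed.

Lemma mlcms_gen_set A : mlcms (gen_set A) = set_lcm A.
Proof.
apply: lepm_anti; last by apply/set_lcmP => i iA; rewrite le_mlcms ?mem_gen_set.
by apply/mlcmsP => _ /imfsetP[i iA ->]; apply: gen_le_set_lcm.
Qed.

Lemma gen_setD1 A i : gen_set (A :\ i) = gen_set A `\ gen i.
Proof.
apply/fsetP => u; rewrite in_fsetD1; apply/imfsetP/andP => [[k /= + ->]|[neq_ui]].
  by rewrite in_setD1 mem_gen_set (inj_eq gen_inj) => /andP[].
by case/imfsetP => k kA eq_u; exists k; rewrite //= in_setD1 kA -(inj_eq gen_inj) -eq_u neq_ui.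
Qed.

Lemma unbroken_preserved A : unbroken A <-> preserved G lt (gen_set A).
Proof.
split=> [unA|[_ presA] D q sDA D0 lt_qD].
  split=> [|C sCA [sCG _ [u [uG le_uC]]]]; first exact: gen_set_sub.
  case/(lt_min_all sCG uG) => C0 lt_uC.
  have [D eq_D] := gen_set_onto sCG; have [q eq_q] := gen_onto uG.
  subst C u; rewrite mlcms_gen_set in le_uC.
  suff: ~~ (gen q <= set_lcm D)%MM by rewrite le_uC.
  apply: unA.
  - by apply/subsetP => i iD; rewrite -mem_gen_set (fsubsetP sCA) // mem_gen_set.
  - by apply: contraNneq C0 => ->; apply/eqP/fsetP => u; apply/imfsetP => -[i]; rewrite inE.
  by move=> i iD; rewrite -lt_genE lt_uC ?mem_gen_set.
apply/negP => le_qD; apply: (presA (gen_set D)).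
  by apply/fsubsetP => _ /imfsetP[i iD ->]; rewrite mem_gen_set (subsetP sDA).
have gen_D0 : gen_set D != fset0.
  by case/set0Pn: D0 => i iD; apply/fset0Pn; exists (gen i); rewrite mem_gen_set.
split=> //; first exact: gen_set_sub.
exists (gen q); split; rewrite ?mem_gen ?mlcms_gen_set //.
apply/lt_min_all; rewrite ?gen_set_sub ?mem_gen //; split=> // _ /imfsetP[i iD ->].
by rewrite lt_genE lt_qD.
Qed.

Lemma minimal_complex_covers : minimal_complex (Lyubeznik_complex K G lt) <->
  forall u (C : {fset 'X_{1..n}}), u \in G -> is_cover G u C -> ~ preserved G lt C.
Proof.
rewrite minimal_complexP; split=> [no_cover u C uG /and3P[sCG uC le_uC]|no_cover A i unA iA].
  have [A eq_A] := gen_set_onto sCG; have [i eq_i] := gen_onto uG.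
  subst C u; rewrite mem_gen_set in uC; rewrite -gen_setD1 mlcms_gen_set in le_uC.
  by move=> /unbroken_preserved unA; have := no_cover A i unA uC; rewrite le_uC.
apply/negP => le_i; apply: (no_cover (gen i) (gen_set A)); first exact: mem_gen.
  by rewrite /is_cover gen_set_sub mem_gen_set iA -gen_setD1 mlcms_gen_set.
exact/unbroken_preserved.
Qed.

End Generators.

Section Covers.
Variables (n : nat) (G : {fset 'X_{1..n}}) (lt : rel 'X_{1..n}).
Hypothesis lt_total : strict_total_order_on G lt.
Hypothesis G_antichain : {in G &, forall u v, (u <= v)%MM -> u = v}.
Implicit Types (C D : {fset 'X_{1..n}}) (u v w : 'X_{1..n}).

Lemma E_minimal_cover_exists u C : is_cover G u C ->
  exists2 C', C' `<=` C & E_minimal_cover G u C'.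
Proof.
have [N] := ubnP #|` C|; elim: N C => // N IHN C; rewrite ltnS => leCN covC.
have [[C' ltC' covC']|noC'] := classic (exists2 C', C' `<` C & is_cover G u C'); last first.
  by exists C => //; split=> // C' ltC'; apply/negP => covC'; apply: noC'; exists C'.
have [|C'' sC'' minC''] := IHN C' _ covC'.
  by apply: leq_trans leCN; apply: fproper_ltn_card.
by exists C'' => //; apply: fsubset_trans sC'' _; apply: fproper_sub.
Qed.

Lemma not_preserved C : C `<=` G ->
  ~ preserved G lt C <-> exists2 D, D `<=` C & broken G lt D.
Proof.
move=> sCG; split=> [nC|[D sDC brD] [_ /(_ D sDC)]//].
apply: NNPP => noD; apply: nC; split=> // D sDC brD; apply: noD; by exists D.
Qed.

(** A witness [w] of brokenness precedes the minimum of [D], hence is not in [D]. *)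
Lemma broken_cover D : broken G lt D -> exists w,
  [/\ w \in G, w \notin D, is_cover G w (w |` D) & {in D, forall d, lt w d}].
Proof.
case=> sDG _ [w [wG le_wD]] /(lt_min_all lt_total sDG wG)[_ lt_wD].
have wD : w \notin D.
  by apply/negP => wD; have := lt_wD w wD; have [-> ] := lt_total.
by exists w; split; rewrite // /is_cover fsubUset fsub1set wG sDG fset1U1 fsetU1K.
Qed.

(** The minimum of the new elements of the closure is at most [w]. *)
Lemma cover_min_lt_min w D : w \notin D -> is_cover G w (w |` D) -> D != fset0 ->
  {in D, forall d, lt w d} -> min_lt_min lt (lcm_closure G D `\` D) D.
Proof.
move=> wD; rewrite /is_cover fsetU1K // fsubUset fsub1set.
move=> /and3P[/andP[wG sDG] _ le_wD] D0 lt_wD.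
have w_cl : w \in lcm_closure G D `\` D by rewrite in_fsetD wD !inE /= wG.
have sclG : lcm_closure G D `\` D `<=` G.
  by apply/fsubsetP => u; rewrite in_fsetD !inE /= => /and3P[].
have [|c c_min] := min_exists lt_total sclG; first by apply/fset0Pn; exists w.
exists c => //; have [/(fsubsetP sclG) cG min_c] := c_min.
apply/(lt_min_all lt_total sDG cG); split=> // d dD.
have [<-|neq_wc] := eqVneq w c; first exact: lt_wD.
have [_ lt_tr _] := lt_total.
apply: (lt_tr w) (min_c w w_cl neq_wc) (lt_wD d dD) => //.
exact: (fsubsetP sDG).
Qed.

Lemma min_lt_min_broken D : D `<=` G ->
  min_lt_min lt (lcm_closure G D `\` D) D -> broken G lt D.
Proof.
move=> sDG [c [+ _] lt_cD]; rewrite in_fsetD !inE /= => /and3P[_ cG le_cD].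
split=> //; last by exists c.
by case: lt_cD => d [dD _] _; apply/fset0Pn; exists d.
Qed.

(** Shrinking a cover of [w] may only remove elements of [D], so [w] still precedes
    what is left. It does not remove all of [D]: otherwise [w] would be the monomial
    1, hence the only generator by the antichain property, although [D] has an
    element other than [w]. *)
Lemma broken_E_minimal_cover D : broken G lt D -> exists D' w,
  [/\ D' `<=` D, w \in G, w \notin D', E_minimal_cover G w (w |` D') &
      min_lt_min lt (lcm_closure G D' `\` D') D'].
Proof.
move=> brD; have [w [wG wD covD lt_wD]] := broken_cover brD.
have [C' sC' minC'] := E_minimal_cover_exists covD.
have [/and3P[_ wC' le_wC'] _] := minC'.
have sD'D : C' `\ w `<=` D by rewrite fsubDset.
exists (C' `\ w), w; rewrite fsetD1K //; split=> //; first by rewrite !inE eqxx.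
apply: (@cover_min_lt_min w); rewrite ?fsetD1K //; first by rewrite !inE eqxx.
- by case: minC'.
- apply: contraNneq wD => D'0; have [sDG D0 _] := brD.
  have /fset0Pn[d dD] := D0; rewrite (G_antichain wG (fsubsetP sDG d dD) _) //.
  by rewrite D'0 in le_wC'; apply: lepm_trans le_wC' _; apply/mlcmsP.
by move=> d /(fsubsetP sD'D)/lt_wD.
Qed.

End Covers.

Theorem corollary3p15 (K : fieldType) (n : nat) (I : {pred {mpoly K[n]}})
    (hI : monomial_ideal I) :
  let G := min_generators I in
  [<-> (* (i) *) Lyubeznik_ideal I;
    (* (ii) *)
    exists2 lt : rel 'X_{1..n}, strict_total_order_on G lt &
      forall (u : 'X_{1..n}) (C : {fset 'X_{1..n}}), u \in G ->
        is_cover G u C -> ~ preserved G lt C;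
    (* (iii) *)
    exists2 lt : rel 'X_{1..n}, strict_total_order_on G lt &
      forall (u : 'X_{1..n}) (C : {fset 'X_{1..n}}), u \in G ->
        is_cover G u C ->
        exists (D : {fset 'X_{1..n}}) (v : 'X_{1..n}),
          [/\ D `<=` C, v \in G, v \notin D, is_cover G v (v |` D) &
              min_lt_min lt (lcm_closure G D `\` D) D];
    (* (iv) *)
    exists2 lt : rel 'X_{1..n}, strict_total_order_on G lt &
      forall (u : 'X_{1..n}) (C : {fset 'X_{1..n}}), u \in G ->
        E_minimal_cover G u C -> ~ preserved G lt C;
    (* (v) *)
    exists2 lt : rel 'X_{1..n}, strict_total_order_on G lt &
      forall (u : 'X_{1..n}) (C : {fset 'X_{1..n}}), u \in G ->
        E_minimal_cover G u C ->
        exists (D : {fset 'X_{1..n}}) (v : 'X_{1..n}),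
          [/\ D `<=` C, v \in G, v \notin D, E_minimal_cover G v (v |` D) &
              min_lt_min lt (lcm_closure G D `\` D) D]].
Proof.
move=> G; have [genG _] := min_generatorsP hI.
have G_antichain := min_generators_antichain (min_generatorsP hI); rewrite -/G in genG G_antichain.
tfae=> [[lt lt_tot [_ minL]]|[lt lt_tot covers]|[lt lt_tot covers]
  |[lt lt_tot covers]|[lt lt_tot covers]]; exists lt => //.
- exact/(minimal_complex_covers lt_tot G_antichain K).
- move=> u C uG covC; have [sCG _] := andP covC.
  have [D sDC brD] := (not_preserved lt sCG).1 (covers u C uG covC).
  have [w [wG wD covD lt_wD]] := broken_cover lt_tot brD.
  exists D, w; split=> //; apply: (cover_min_lt_min lt_tot wD) => //.
  by case: brD.
- move=> u C uG [covC _]; have [sCG _] := andP covC.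
  have [D [v [sDC _ _ _ minD]]] := covers u C uG covC.
  apply/not_preserved => //; exists D => //; apply: min_lt_min_broken minD.
  exact: fsubset_trans sCG.
- move=> u C uG minC; have [/andP[sCG _] _] := minC.
  have [D sDC brD] := (not_preserved lt sCG).1 (covers u C uG minC).
  have [D' [w [sD'D wG wD' minD' lt_minD']]] := broken_E_minimal_cover lt_tot G_antichain brD.
  by exists D', w; split=> //; apply: fsubset_trans sDC.
split; first exact: Lyubeznik_resolution.
apply/(minimal_complex_covers lt_tot G_antichain K) => u C uG covC.
have [sCG _] := andP covC; have [C' sC'C minC'] := E_minimal_cover_exists covC.
have [D [v [sDC' _ _ _ minD]]] := covers u C' uG minC'.
apply/not_preserved => //; exists D; first exact: fsubset_trans sC'C.
apply: min_lt_min_broken minD; apply: fsubset_trans sCG.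
exact: fsubset_trans sC'C.
Qed.
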